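(* Consider $\mathsf{Broadcast}$ algorithms that must work on every network of maximum degree at most $\Delta$ (in particular on every complete bipartite graph $K_{2,k}$ with $1\le k\le\Delta$, with the source being one of the two vertices of the size-2 side). Then: (i) in the deterministic $\mathsf{No}\text{-}\mathsf{CD}$ model, any such algorithm requires $\Omega(\Delta)$ energy; (ii) in the randomized $\mathsf{No}\text{-}\mathsf{CD}$ model, any such algorithm succeeding with high probability requires $\Omega(\log\Delta\log n)$ energy; (iii) in the randomized $\mathsf{CD}$ model, any such algorithm succeeding with high probability requires $\Omega(\log n)$ energy.
   Context: Radio network model: the network is a connected undirected graph $G=(V,E)$ with $n=|V|$ vertices and maximum degree $\Delta$; vertices know $n$ and $\Delta$ but not the topology. Time is divided into synchronized slots; in each slot a vertex transmits, listens, or is idle. Transmitting or listening costs one unit of energy, idling is free; the energy of an algorithm is the maximum over vertices of the number of slots in which the vertex transmits or listens. A listener with exactly one transmitting neighbor receives that neighbor's message. In $\mathsf{No}\text{-}\mathsf{CD}$, if zero or at least two neighbors transmit, the listener hears silence. In $\mathsf{CD}$, if zero neighbors transmit the listener hears silence, and if at least two transmit it hears a distinct ''noise'' signal. Transmitters receive no feedback. In the deterministic setting vertices have distinct IDs in $\{1,\ldots,N\}$; in the randomized setting they have private random bits, and ''with high probability'' means with failure probability at most $1/\mathrm{poly}(n)$. In $\mathsf{Broadcast}$, a source vertex holds a message $m$ and all vertices must learn $m$. *)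

(* Defs.v *)
From mathcomp Require Import all_boot.
Set Implicit Arguments.
Unset Strict Implicit.
Unset Printing Implicit Defensive.

(* What a vertex does in one slot. Packets are arbitrary (encoded as nat). *)
Inductive action := Idle | Listen | Transmit of nat.

(* What a vertex perceives in one slot:
   ONone   : it was idle or transmitting (transmitters get no feedback);
   OSilence: it listened and heard silence;
   OMsg p  : it listened and exactly one neighbour transmitted p;
   ONoise  : it listened and >= 2 neighbours transmitted (CD model only). *)
Inductive obs := ONone | OSilence | OMsg of nat | ONoise.

Definition is_active (a : action) : bool :=
  if a is Idle then false else true.

Definition is_transmit (a : action) : bool :=
  if a is Transmit _ then true else false.

(* A (local, distributed) algorithm whose vertices have local input of type I:
   in each slot a vertex chooses its action from its input and its history
   of observations (whose length is the current slot number); at the end it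
   outputs the message it believes to be m. *)
Record algo (I : Type) := Algo {
  act : I -> seq obs -> action ;
  out : I -> seq obs -> nat }.

Section Exec.
Variables (I : Type) (cd : bool) (V : finType) (adj : rel V)
          (A : algo I) (inp : V -> I).

Definition observe (acts : V -> action) (v : V) : obs :=
  match acts v with
  | Listen =>
      match [seq u <- enum V | adj u v && is_transmit (acts u)] with
      | [::] => OSilence
      | [:: u] => if acts u is Transmit p then OMsg p else OSilence
      | _ => if cd then ONoise else OSilence
      end
  | _ => ONone
  end.

Fixpoint hists (t : nat) : V -> seq obs :=
  match t with
  | 0 => fun _ => [::]
  | t'.+1 =>
      let h := hists t' in
      fun v => rcons (h v) (observe (fun u => act A (inp u) (h u)) v)
  end.

Definition energy (T : nat) (v : V) : nat :=
  \sum_(t < T) is_active (act A (inp v) (hists t v)).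

Definition success (T : nat) (m : nat) : bool :=
  [forall v, out A (inp v) (hists T v) == m].
End Exec.

Definition K2 (k : nat) : rel 'I_k.+2 := fun u v => (u < 2) != (v < 2).

Definition src_info (k m : nat) (v : 'I_k.+2) : option nat :=
  if v == ord0 then Some m else None.

(* Local input: (ID, Some m if source else None).  n, Delta, N are known to
   the algorithm since the algorithm is chosen after them. *)
Definition det_input (k m : nat) (id : 'I_k.+2 -> nat) (v : 'I_k.+2)
  : nat * option nat := (id v, src_info m v).

Definition valid_ids (N k : nat) (id : 'I_k.+2 -> nat) : Prop :=
  injective id /\ forall v, 1 <= id v <= N.
Arguments valid_ids : clear implicits.

Definition det_broadcast_ok (cd : bool) (N Delta T : nat)
    (A : algo (nat * option nat)) : Prop :=
  forall k, 1 <= k <= Delta -> forall id, valid_ids N k id -> forall m,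
    success cd (K2 (k:=k)) A (det_input m id) T m.

Definition det_energy_le (cd : bool) (N Delta T : nat)
    (A : algo (nat * option nat)) (E : nat) : Prop :=
  forall k, 1 <= k <= Delta -> forall id, valid_ids N k id -> forall m v,
    energy cd (K2 (k:=k)) A (det_input m id) T v <= E.

(* Vertices are anonymous; each has a private string of R uniformly random
   bits.  Local input: (random bits, Some m if source else None). *)
Definition rand_input (k m R : nat) (seed : {ffun 'I_k.+2 -> R.-tuple bool})
    (v : 'I_k.+2) : seq bool * option nat := (tval (seed v), src_info m v).

(* Succeeds with high probability: on every K_{2,k}, 1 <= k <= Delta, and
   every message m, the probability (over the 2^(R(k+2)) equally likely seed
   assignments) that some vertex fails to learn m within T slots is <= 1/n. *)
Definition rand_broadcast_whp (cd : bool) (n Delta R T : nat)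
    (A : algo (seq bool * option nat)) : Prop :=
  forall k, 1 <= k <= Delta -> forall m,
    #|[set seed : {ffun 'I_k.+2 -> R.-tuple bool} |
        ~~ success cd (K2 (k:=k)) A (rand_input m seed) T m]| * n
    <= 2 ^ (R * k.+2).

Definition rand_energy_le (cd : bool) (Delta R T : nat)
    (A : algo (seq bool * option nat)) (E : nat) : Prop :=
  forall k, 1 <= k <= Delta -> forall m (seed : {ffun 'I_k.+2 -> R.-tuple bool}) v,
    energy cd (K2 (k:=k)) A (rand_input m seed) T v <= E.

(* Main.v *)
Require Import Defs.
From mathcomp Require Import all_boot all_order all_algebra.
From mathcomp Require Import reals Rstruct sequences exp.
From mathcomp Require Import zify ring lra.

(** As long as no slot in which one of the two hubs (the size-2 side of K_{2,k})
    listens has exactly one transmitting leaf, the hubs hear no message, so for a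
    fresh message m the sink fails.

    (i) The hubs then hear only silence, so their schedule and the schedule of
    every leaf are fixed by its ID.  Starting from Delta leaves and deleting, for
    each listening slot, the leaf that is alone in it, some leaf survives unless
    the hubs listen at least Delta times.

    (ii) For k = 2 * 2^j, cut the leaves into two independent halves.  If both
    halves have the same pattern, i.e. for every listening slot both or neither
    contain a transmitter, no leaf is ever alone.  Two independent copies of a
    random pattern agree with probability at least exp (- entropy), and the
    entropy is at most the sum over slots of the entropy of the event "some one of
    2^j leaves transmits".  For a slot of transmission probability p the latter
    decays geometrically in the distance of 2^j to the scale 1/p, so its sum
    over all j is O(1): some scale j has entropy O(E / log Delta), and
    exp (- O(E / log Delta)) <= 1/n.

    (iii) With two leaves, the transcript of silence and noise heard by the hubs
    when both leaves carry the same seed r is a function of r with at most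
    2^(2E) values.  Two leaves whose seeds have the same transcript behave in
    unison, which happens with probability at least 2^(-2E). *)
Set Implicit Arguments.
Unset Strict Implicit.
Unset Printing Implicit Defensive.

(** * Runs in which the hubs hear no message *)

Definition is_listen (a : action) : bool := if a is Listen then true else false.

Definition is_msg (o : obs) : bool := if o is OMsg _ then true else false.

Definition sink k : 'I_k.+2 := lift ord0 ord0.

(* The shadow of a leaf input i is the run in which all leaves (at least two) have
   input i and therefore act in unison: its components are the histories of the
   source, of the sink, and of the leaves. *)
Section Shadow.
Variables (I : Type) (cd : bool) (A : algo I) (i0 i1 : I).

(** [busy] stands for at least two talking leaves. The case of a single one is left out, so a hub
    never perceives [OMsg]. *)
Definition hub_obs (a : action) (busy : bool) : obs :=
  if a is Listen then if cd && busy then ONoise else OSilence else ONone.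

Definition leaf_obs (a a0 a1 : action) : obs :=
  if a is Listen then
    match a0, a1 with
    | Transmit _, Transmit _ => if cd then ONoise else OSilence
    | Transmit p, _ | _, Transmit p => OMsg p
    | _, _ => OSilence
    end
  else ONone.

Fixpoint shadow (i : I) (t : nat) : seq obs * seq obs * seq obs :=
  if t is t'.+1 then
    let h := shadow i t' in
    let a0 := act A i0 h.1.1 in
    let a1 := act A i1 h.1.2 in
    let a := act A i h.2 in
    (rcons h.1.1 (hub_obs a0 (is_transmit a)),
     rcons h.1.2 (hub_obs a1 (is_transmit a)),
     rcons h.2 (leaf_obs a a0 a1))
  else ([::], [::], [::]).

Definition talks i t : bool := is_transmit (act A i (shadow i t).2).

Definition hub_listens i t : bool :=
  is_listen (act A i0 (shadow i t).1.1) || is_listen (act A i1 (shadow i t).1.2).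

Lemma observe_hub k (acts : 'I_k.+2 -> action) (v : 'I_k.+2) (busy : bool) :
    v < 2 ->
    (is_listen (acts v) ->
      let c := #|[set w : 'I_k.+2 | (2 <= w) && is_transmit (acts w)]| in
      c != 1 /\ (cd -> busy = (1 < c))) ->
  observe cd (K2 (k:=k)) acts v = hub_obs (acts v) busy.
Proof.
move=> v2; rewrite /observe /hub_obs; case: (acts v) => //= /(_ isT).
have -> : #|[set w : 'I_k.+2 | (2 <= w) && is_transmit (acts w)]| =
          size [seq u <- enum 'I_k.+2 | K2 u v && is_transmit (acts u)].
  rewrite cardE /enum_mem -filter_predI; congr size; apply: eq_filter => u.
  by rewrite !inE /K2 v2 ltnNge eqb_id andbT; case: (1 < u).
case: (filter _ _) => [|u [|w s]] /= [].
- by move=> _; case: cd => // ->.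
- by [].
- by move=> _; case: cd => // ->.
Qed.

Lemma observe_leaf k (acts : 'I_k.+2 -> action) (v : 'I_k.+2) : 2 <= v ->
  observe cd (K2 (k:=k)) acts v = leaf_obs (acts v) (acts ord0) (acts (sink k)).
Proof.
move=> v2; rewrite /observe /leaf_obs; case: (acts v) => //=.
have -> : [seq u <- enum 'I_k.+2 | K2 u v && is_transmit (acts u)] =
          [seq u <- [:: ord0; sink k] | is_transmit (acts u)].
  rewrite !enum_ordSl /= /K2 /= (ltnNge v) v2 /= -/(sink k).
  rewrite (@eq_in_filter _ _ pred0 (map _ _)) ?filter_pred0 // => u.
  by case/mapP => w /mapP[x _ ->] ->.
set h := sink k; rewrite /=; case E0: (acts ord0) => [||p]; case E1: (acts h) => [||q] /=;
  rewrite ?E0 ?E1 //.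
Qed.

(** By induction on slots. The leaves may have different inputs: a leaf hears only the hubs, the
    hubs follow one common shadow, and they hear what it predicts as long as no leaf talks alone
    while they listen. *)
Lemma hists_shadow k T (inp : 'I_k.+2 -> I) :
    0 < k -> inp ord0 = i0 -> inp (sink k) = i1 ->
    (forall v w : 'I_k.+2, 2 <= v -> 2 <= w -> forall t, t <= T ->
      (shadow (inp v) t).1 = (shadow (inp w) t).1) ->
    (forall t (v : 'I_k.+2), t < T -> 2 <= v -> hub_listens (inp v) t ->
      let c := #|[set w : 'I_k.+2 | (2 <= w) && talks (inp w) t]| in
      c != 1 /\ (cd -> talks (inp v) t = (1 < c))) ->
  forall t, t <= T -> forall v : 'I_k.+2, 2 <= v ->
    let h := hists cd (K2 (k:=k)) A inp t in
    (h ord0, h (sink k), h v) = shadow (inp v) t.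
Proof.
move=> k_gt0 E0 E1 same nohit; elim=> [//|t IHt] tT v v2 /=.
have {}IHt := IHt (ltnW tT).
set h := hists _ _ _ _ t in IHt *.
have [h0 h1 hv] : [/\ h ord0 = (shadow (inp v) t).1.1,
    h (sink k) = (shadow (inp v) t).1.2 & h v = (shadow (inp v) t).2].
  by rewrite -(IHt v v2).
have talkE : [set w : 'I_k.+2 | (2 <= w) && is_transmit (act A (inp w) (h w))] =
             [set w : 'I_k.+2 | (2 <= w) && talks (inp w) t].
  apply/setP => w; rewrite !inE; case w2: (2 <= w) => //=.
  by rewrite /talks -(IHt w w2).
have hubE (u : 'I_k.+2) : u < 2 ->
    (is_listen (act A (inp u) (h u)) -> hub_listens (inp v) t) ->
    observe cd (K2 (k:=k)) (fun u => act A (inp u) (h u)) u =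
    hub_obs (act A (inp u) (h u)) (talks (inp v) t).
  move=> u2 Hu; apply: observe_hub => // /Hu Hl; rewrite talkE.
  exact: nohit.
rewrite hubE //; last by rewrite /hub_listens E0 h0 => ->.
rewrite hubE //; last by rewrite /hub_listens E1 h1 => ->; rewrite orbT.
by rewrite observe_leaf // /talks E0 E1 h0 h1 hv.
Qed.

Lemma shadow_no_msg i t :
  (size (shadow i t).1.2 = t) * ~~ has is_msg (shadow i t).1.2.
Proof.
elim: t => //= t [IHs IHm]; rewrite size_rcons has_rcons IHs negb_or IHm andbT.
by split=> //; rewrite /hub_obs; case: (act _ _ _) => //=; case: ifP.
Qed.

End Shadow.

(** Without collision detection [hub_obs] ignores the leaves. *)
Lemma shadow_nocd (I : Type) (A : algo I) i0 i1 i j t :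
  (shadow false A i0 i1 i t).1 = (shadow false A i0 i1 j t).1.
Proof. by elim: t => //= t ->. Qed.

Lemma card_neq1 (W : finType) (D : {set W}) :
  (forall w, w \in D -> exists2 w', w' \in D & w' != w) -> #|D| != 1.
Proof.
move=> H; apply/negP => /cards1P[w Dw].
by have [|w'] := H w; rewrite Dw ?set11 // inE => /eqP->; rewrite eqxx.
Qed.

(** Message-free histories of length T form a finite set, as do the inputs x, so the outputs on them
    are bounded. A message above the bound cannot be guessed by the sink, whose input does not
    contain it. *)
Lemma fresh_message (S : finType) T (f : S -> seq obs -> nat) :
  exists m, forall x h, size h = T -> ~~ has is_msg h -> f x h < m.
Proof.
pose dec (o : option bool) :=
  if o is Some b then if b then ONoise else OSilence else ONone.
pose enc o := if o is ONoise then Some true else if o is OSilence then Some false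
              else None.
pose F (x : S * T.-tuple (option bool)) := f x.1 (map dec x.2).
exists (\max_x F x).+1 => x h hT hm; rewrite ltnS.
have sz : size (map enc h) == T by rewrite size_map hT.
suff -> : f x h = F (x, Tuple sz) by apply: leq_bigmax.
rewrite /F /= -map_comp; congr f; elim: h hm {hT sz} => //= o h IH.
by rewrite negb_or => /andP[om /IH <-]; case: o om.
Qed.

(** * Vertices of K_{2,k} and lone talkers *)

Definition leaf k (x : 'I_k) : 'I_k.+2 := rshift 2 x.

Variant vertex_spec k : 'I_k.+2 -> Type :=
  | IsSource : vertex_spec ord0
  | IsSink : vertex_spec (sink k)
  | IsLeaf x : vertex_spec (leaf x).

Lemma vertexP k (v : 'I_k.+2) : vertex_spec v.
Proof.
case: (splitP (v : 'I_(2 + k))) => [[[|[|//]] u2] /= vE|x vE].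
- by have -> : v = ord0 by [apply: val_inj]; constructor.
- by have -> : v = sink k by [apply: val_inj]; constructor.
- by have -> : v = leaf x by [apply: val_inj]; constructor.
Qed.

Lemma card_leaves k (P : pred 'I_k.+2) :
  #|[set w : 'I_k.+2 | (2 <= w) && P w]| = #|[set x : 'I_k | P (leaf x)]|.
Proof.
rewrite -(card_imset _ (@rshift_inj 2 k)); congr #|pred_of_set _|.
apply/setP => w; rewrite inE; apply/andP/imsetP => [[w2 Pw]|[x + ->]].
  by case: (vertexP w) w2 Pw => // x _ Px; exists x; rewrite ?inE.
by rewrite inE.
Qed.

Definition vfun k (X : Type) (a b : X) (f : 'I_k -> X) (v : 'I_k.+2) : X :=
  match split (v : 'I_(2 + k)) with
  | inl u => if u == ord0 then a else b
  | inr x => f x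
  end.

Section Vfun.
Variables (k : nat) (X : Type) (a b : X) (f : 'I_k -> X).

Lemma vfun_leaf x : vfun a b f (leaf x) = f x.
Proof. by rewrite /vfun (unsplitK (inr x : 'I_2 + 'I_k)). Qed.

Lemma vfun_source : vfun a b f ord0 = a.
Proof.
have -> : ord0 = unsplit (inl ord0 : 'I_2 + 'I_k) by apply: val_inj.
by rewrite /vfun unsplitK.
Qed.

Lemma vfun_sink : vfun a b f (sink k) = b.
Proof.
have -> : sink k = unsplit (inl ord_max : 'I_2 + 'I_k) by apply: val_inj.
by rewrite /vfun unsplitK.
Qed.

Definition vfunE := (vfun_source, vfun_sink, vfun_leaf).

End Vfun.

Section NoLoneTalker.
Variables (I : Type) (cd : bool) (A : algo I) (k : nat) (inp : 'I_k.+2 -> I).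

Let sh := shadow cd A (inp ord0) (inp (sink k)).
Let tk x := talks cd A (inp ord0) (inp (sink k)) (inp (leaf x)).
Let lst x := hub_listens cd A (inp ord0) (inp (sink k)) (inp (leaf x)).

(* The first condition, void without collision detection, says that the shadows
   of the leaf inputs agree on what the hubs hear; the actual run of the hubs is
   then this common shadow. *)
Definition no_lone_talker (T : nat) : Prop :=
  (forall x y t, t <= T -> (sh (inp (leaf x)) t).1 = (sh (inp (leaf y)) t).1) /\
  (forall t x, t < T -> lst x t ->
    let c := #|[set y : 'I_k | tk y t]| in
    c != 1 /\ (cd -> tk x t = (1 < c))).

Lemma hists_shadowP T (x : 'I_k) : no_lone_talker T -> forall t, t <= T ->
  let h := hists cd (K2 (k:=k)) A inp t in (h ord0, h (sink k)) = (sh (inp (leaf x)) t).1.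
Proof.
move=> [same nolone] t tT.
have k_gt0 : 0 < k by case: (k) x => // -[].
have := @hists_shadow I cd A _ _ k T inp k_gt0 erefl erefl _ _ t tT (leaf x) isT.
rewrite /= -/sh => <- //.
  move=> v w; case: (vertexP v) => // y _; case: (vertexP w) => // z _ s.
  exact: same.
move=> s v; case: (vertexP v) => // y sT _ /(nolone _ _ sT).
by rewrite card_leaves.
Qed.

(** A slot counted on the left costs at least one hub a unit. The separate horizon T' makes the
    bound usable when only a prefix of the run is known to be free of lone talkers. *)
Lemma sum_hub_listens_le T T' (x : 'I_k) : T' <= T -> no_lone_talker T' ->
  \sum_(t < T') lst x t <=
  energy cd (K2 (k:=k)) A inp T ord0 + energy cd (K2 (k:=k)) A inp T (sink k).
Proof.
move=> T'T nl; rewrite /energy -big_split /=.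
rewrite -(big_mkord xpredT (fun t => nat_of_bool (lst x t))).
pose h := hists cd (K2 (k:=k)) A inp.
rewrite -(big_mkord xpredT (fun t => is_active (act A (inp ord0) (h t ord0)) +
  is_active (act A (inp (sink k)) (h t (sink k))))).
rewrite [leqRHS](big_cat_nat (leq0n T') T'T) /=; apply: leq_trans (leq_addr _ _).
rewrite !big_mkord; apply: leq_sum => t _; rewrite /lst /hub_listens.
have := hists_shadowP x nl (ltnW (ltn_ord t)); rewrite /= -/sh /h => <- /=.
by case: (act A (inp ord0) _); case: (act A (inp (sink k)) _).
Qed.

Lemma no_lone_talker_fails T m : 0 < k -> no_lone_talker T ->
    (forall h, size h = T -> ~~ has is_msg h -> out A (inp (sink k)) h < m) ->
  ~~ success cd (K2 (k:=k)) A inp T m.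
Proof.
move=> k_gt0 nl small; apply/forallPn; exists (sink k).
have := hists_shadowP (Ordinal k_gt0) nl (leqnn T).
case/(congr1 snd) => /= ->; apply/negP => /eqP E.
have [sz nomsg] :=
  shadow_no_msg cd A (inp ord0) (inp (sink k)) (inp (leaf (Ordinal k_gt0))) T.
by have := small _ sz nomsg; rewrite E ltnn.
Qed.

End NoLoneTalker.

(** * No collision detection: lone talkers and the deterministic bound *)

Lemma no_lone_talker_nocd (I : Type) (A : algo I) k (inp : 'I_k.+2 -> I) T :
    (forall t x, t < T ->
      hub_listens false A (inp ord0) (inp (sink k)) (inp (leaf x)) t ->
      #|[set y : 'I_k |
          talks false A (inp ord0) (inp (sink k)) (inp (leaf y)) t]| != 1) ->
  no_lone_talker false A inp T.
Proof. by move=> H; split=> [x y t _|t x /H/[apply]]; first exact: shadow_nocd. Qed.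

Lemma hub_listens_nocd (I : Type) (A : algo I) i0 i1 i j t :
  hub_listens false A i0 i1 i t = hub_listens false A i0 i1 j t.
Proof. by rewrite /hub_listens (shadow_nocd A i0 i1 i j). Qed.

(* Deleting the lone element of a set costs that set, which the remaining
   elements then avoid altogether. *)
Lemma no_lone_subset (W : finType) (Xs : seq {set W}) (S0 : {set W}) :
  size Xs < #|S0| ->
  exists2 S : {set W}, S != set0 & forall X, X \in Xs -> #|S :&: X| != 1.
Proof.
(* Induction needs [S \subset S0], which keeps a deleted element out of the final set. *)
suff: size Xs < #|S0| -> exists S : {set W}, [/\ S \subset S0, S != set0 &
    forall X, X \in Xs -> #|S :&: X| != 1].
  by move=> H /H[S [_ S0' HS]]; exists S.
have [n] := ubnP (size Xs); elim: n Xs S0 => // n IHn Xs S0 sXn sXS.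
have [/hasP[X XXs /cards1P[x SX]]|/hasPn ok] :=
  boolP (has (fun X => #|S0 :&: X| == 1) Xs); last first.
  by exists S0; split=> //; rewrite -card_gt0; apply: leq_ltn_trans sXS.
have xS : x \in S0 by have /setIP[] : x \in S0 :&: X by rewrite SX set11.
have Xs_gt0 : 0 < size Xs by case: (Xs) XXs.
have [||S [sub nz ok]] := IHn (rem X Xs) (S0 :\ x).
- by rewrite size_rem // -ltnS prednK.
- by rewrite size_rem // -ltnS prednK // (leq_trans sXS) // (cardsD1 x S0) xS.
exists S; split=> //; first exact: subset_trans sub (subD1set _ _).
move=> Y YXs; have [->|YX] := eqVneq Y X; last first.
  by apply: ok; move: YXs; rewrite (perm_mem (perm_to_rem XXs)) inE (negPf YX).
suff -> : S :&: X = set0 by rewrite cards0.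
apply/setP => y; rewrite !inE; apply/negP => /andP[yS yX].
have := subsetP sub y yS; rewrite !inE => /andP[yx yS0].
have : y \in S0 :&: X by rewrite inE yS0.
by rewrite SX inE (negPf yx).
Qed.

(** The leaf set is chosen from the hub schedule [L], while the energy bound applies only to actual
    networks. Hence [cntL] bounds the schedule slot by slot, with a new network for each prefix. *)
Lemma det_nocd_lower Delta N T E (A : algo (nat * option nat)) :
    1 < Delta -> Delta.+2 <= N ->
    det_broadcast_ok false N Delta T A -> det_energy_le false N Delta T A E ->
  Delta <= 3 * E.
Proof.
move=> D1 DN okA enA.
have [m fresh] := @fresh_message unit T (fun _ h => out A (2, None) h).
pose i0 := (1, Some m); pose i1 : nat * option nat := (2, None).
pose node (x : 'I_Delta) : nat * option nat := (x.+3, None).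
(* The leaf input [(3, None)] is arbitrary: the hub schedule does not depend on it. *)
pose L t := hub_listens false A i0 i1 (3, None) t.
pose tk t := [set x | talks false A i0 i1 (node x) t].
have run T' : T' <= T -> \sum_(t < T') L t < Delta ->
    exists2 k, 0 < k <= Delta & exists2 id, valid_ids N k id &
      det_input m id ord0 = i0 /\ det_input m id (sink k) = i1 /\
      no_lone_talker false A (det_input m id) T'.
  move=> T'T sL.
  have sXs : size [seq tk t | t <- iota 0 T' & L t] < #|[set: 'I_Delta]|.
    rewrite size_map size_filter cardsT card_ord; apply: leq_ltn_trans sL.
    have -> : iota 0 T' = index_iota 0 T' by rewrite /index_iota subn0.
    rewrite -sum1_count big_mkcond /=.
    by rewrite big_mkord; apply: leq_sum => t _; case: (L t).
  have [S S0 loneS] := no_lone_subset sXs.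
  exists #|S|; first by rewrite card_gt0 S0 -[leqRHS]card_ord max_card.
  pose id := vfun 1 2 (fun x : 'I_#|S| => (enum_val x).+3).
  have [id0 id1] : id ord0 = 1 /\ id (sink #|S|) = 2 by rewrite /id !vfunE.
  have idl x : id (leaf x) = (enum_val x).+3 by rewrite /id vfunE.
  exists id.
    split=> [v w|v]; last first.
      case: (vertexP v) => [||x]; rewrite ?id0 ?id1 ?idl /=.
      - by apply: leq_trans DN.
      - by apply: leq_trans DN.
      - by apply: leq_trans DN; rewrite !ltnS.
    case: (vertexP v) => [||x]; case: (vertexP w) => [||y];
      rewrite ?id0 ?id1 ?idl //.
    by case=> /val_inj/enum_val_inj->.
  have e0 : det_input m id ord0 = i0 by rewrite /det_input id0 /src_info eqxx.
  have e1 : det_input m id (sink #|S|) = i1 by rewrite /det_input id1.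
  have el x : det_input m id (leaf x) = node (enum_val x) by rewrite /det_input idl.
  split=> //; split=> //; apply: no_lone_talker_nocd => t x tT'.
  rewrite e0 e1 (hub_listens_nocd _ _ _ _ (3, None)) -/(L t) => Lt.
  have : tk t \in [seq tk t | t <- iota 0 T' & L t].
    by apply: map_f; rewrite mem_filter Lt mem_iota.
  move/loneS; rewrite -(card_imset _ enum_val_inj).
  suff -> : S :&: tk t = [set enum_val y | y : 'I_#|S| in
     [set y | talks false A i0 i1 (det_input m id (leaf y)) t]] by [].
  apply/setP => y; rewrite !inE; apply/andP/imsetP => [[yS ty]|[z + ->]].
    by exists (enum_rank_in yS y); rewrite ?inE ?el enum_rankK_in.
  by rewrite inE el => ->; rewrite enum_valP.
(* One more slot raises the count to at most 2E + 1. If this is below Delta, [run] gives a network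
   in which the prefix really occurs, and its energy bounds the count by 2E again. *)
have cntL T' : T' <= T -> \sum_(t < T') L t <= E + E \/ Delta <= (E + E).+1.
  elim: T' => [|T' IH] T'T; first by rewrite big_ord0; left.
  have [|IHle] := IH (ltnW T'T); last by right.
  have [|DE] := leqP Delta (E + E).+1; first by right.
  move=> IHle; left; have [|k kD [id ids [e0 [e1 nl]]]] := run _ T'T.
    apply: leq_ltn_trans DE; rewrite big_ord_recr /= -addn1.
    by apply: leq_add => //; case: (L _).
  have k_gt0 : 0 < k by case/andP: kD.
  apply: leq_trans (leq_add (enA _ kD _ ids m ord0) (enA _ kD _ ids m (sink k))).
  apply: leq_trans (sum_hub_listens_le (Ordinal k_gt0) T'T nl); rewrite e0 e1.
  by apply: leq_sum => t _; rewrite /L (hub_listens_nocd _ _ _ _ (3, None)).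
(* The constant 3: 2E + 1 <= 3E for positive E, and E = 0 would give Delta <= 1. *)
have [le2E|] := cntL T (leqnn T); last first.
  by case: (E) => [|e]; [rewrite leqNgt D1 | move/leq_trans; apply; rewrite !mulSn; lia].
have [|DE] := ltnP (\sum_(t < T) L t) Delta; last first.
  by apply: leq_trans DE (leq_trans le2E _); rewrite !mulSn mul0n addn0 leq_addl.
case/(run _ (leqnn T)) => k kD [id ids [e0 [e1 nl]]].
have k_gt0 : 0 < k by case/andP: kD.
have /negP[] : ~~ success false (K2 (k:=k)) A (det_input m id) T m.
  by apply: no_lone_talker_fails => // h; rewrite e1; apply: (fresh tt).
exact: okA.
Qed.

(** * Collision probability and exponential estimates *)

Section Collisions.
Import Order.TTheory GRing.Theory Num.Theory.
Local Open Scope ring_scope.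
Variable R : realType.

Lemma card_preim_sum (Z B : finType) (b : Z -> B) (v : B -> R) :
  \sum_f v f *+ #|[set z | b z == f]| = \sum_z v (b z).
Proof.
rewrite (partition_big b xpredT) //=; apply: eq_bigr => f _.
rewrite (eq_bigr (fun=> v f)) => [|z /eqP-> //].
by rewrite sumr_const; congr (_ *+ _); apply: eq_card => z; rewrite !inE.
Qed.

(* A form of Gibbs' inequality: for y = ln (Pr [b z' = b z]) and c the mean of
   u (b z), add up exp (y - c) >= 1 + y - c and exp (u - y) >= 1 + u - y, and
   average over z. *)
Lemma collision_ge (Z B : finType) (b : Z -> B) (u : B -> R) :
    (0 < #|Z|)%N -> \sum_f expR (u f) <= 1 ->
  #|Z|%:R ^+ 2 * expR ((\sum_z u (b z)) / #|Z|%:R) <=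
    #|[set p : Z * Z | b p.1 == b p.2]|%:R.
Proof.
move=> Z0 u1; set N : R := #|Z|%:R; have N0 : 0 < N by rewrite ltr0n.
set c := _ / N; pose n z := #|[set z' | b z' == b z]|.
have n0 z : 0 < (n z)%:R :> R.
  by rewrite ltr0n card_gt0; apply/set0Pn; exists z; rewrite inE.
have -> : #|[set p : Z * Z | b p.1 == b p.2]| = (\sum_z n z)%N.
  rewrite -sum1_card (eq_bigl (fun p : Z * Z => b p.1 == b p.2)); last first.
    by move=> p; rewrite inE.
  rewrite -(pair_big_dep xpredT (fun z z' => b z == b z') (fun _ _ => 1%N)) /=.
  apply: eq_bigr => z _; rewrite /n -sum1_card; apply: eq_bigl => z'.
  by rewrite inE eq_sym.
have pt z : 2 + u (b z) - c - expR (u (b z)) * N / (n z)%:R <= expR (- c) * (n z)%:R / N.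
  pose y := ln ((n z)%:R / N).
  have ey : expR y = (n z)%:R / N by rewrite lnK // posrE divr_gt0.
  have := expR_ge1Dx (y - c); have := expR_ge1Dx (u (b z) - y).
  rewrite !expRD (expRN y) ey invf_div mulrA [expR (- c) * _ / _]mulrAC.
  rewrite [_ * expR (- c)]mulrC mulrA; set a := _ / _; set d := _ / N.
  by rewrite [_ / N * _]mulrAC -/d => h1 h2; lra.
have : \sum_z (2 + u (b z) - c - expR (u (b z)) * N / (n z)%:R) <=
       \sum_z expR (- c) * (n z)%:R / N by apply: ler_sum.
rewrite -mulr_suml -mulr_sumr -natr_sum; set C := (\sum_z n z)%N.
rewrite sumrB sumrB big_split /= !sumr_const -/N.
have -> : \sum_z u (b z) = c *+ #|Z| by rewrite -mulr_natr -/N /c mulfVK // gt_eqF.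
(* Grouping the z by their value f cancels the fibre size, which leaves N times the sum of exp (u f)
   over the attained f. *)
have le1 : \sum_z expR (u (b z)) * N / (n z)%:R <= N.
  rewrite -(@card_preim_sum Z B b (fun f => expR (u f) * N / #|[set z' | b z' == f]|%:R)).
  apply: le_trans (_ : \sum_f expR (u f) * N <= _); last first.
    by rewrite -mulr_suml ler_piMl // ltW.
  apply: ler_sum => f _ /=; rewrite -[leLHS]mulr_natr; set k := #|_|.
  have [->|k0] := posnP k; first by rewrite mulr0 mulr_ge0 ?expR_ge0 // ltW.
  by rewrite mulfVK // pnatr_eq0 -lt0n.
move=> h; have {}h : N <= expR (- c) * C%:R / N.
  have cT : #|(xpredT : pred Z)| = #|Z| by apply: eq_card.
  by move: h; rewrite cT addrK -[2 *+ _]mulr_natr -/N; lra.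
rewrite -ler_pdivlMr ?expR_gt0 // -expRN mulrC.
by rewrite expr2 -ler_pdivlMr.
Qed.

Lemma bernoulli_le (p : R) n : 0 <= p <= 1 -> 1 - n%:R * p <= (1 - p) ^+ n.
Proof.
move=> p01; elim: n => [|n IH]; first by rewrite expr0 mul0r subr0.
rewrite exprS; apply: le_trans (_ : (1 - p) * (1 - n%:R * p) <= _); last first.
  by apply: ler_wpM2l => //; lra.
have : 0 <= n%:R :> R by [].
rewrite -natr1; nra.
Qed.

Lemma bernoulli_inv (p : R) n : 0 <= p <= 1 -> (1 - p) ^+ n * (1 + n%:R * p) <= 1.
Proof.
move=> p01; elim: n => [|n IH]; first by rewrite expr0 mul0r addr0 mulr1.
apply: le_trans IH; rewrite exprSr -mulrA ler_wpM2l ?exprn_ge0 //; first lra.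
have : 0 <= n%:R :> R by [].
rewrite -natr1; nra.
Qed.

Lemma sum_arith_geom D : \sum_(d < D) (d.+1%:R * 2^-1 ^+ d) <= 4 :> R.
Proof.
suff -> : \sum_(d < D) (d.+1%:R * 2^-1 ^+ d) = 4 - 2 * (D.+2%:R * 2^-1 ^+ D) :> R.
  by rewrite gerBl mulr_ge0 // mulr_ge0 // exprn_ge0 // invr_ge0.
elim: D => [|D IH]; first by rewrite big_ord0 expr0; lra.
by rewrite big_ord_recr IH /= exprS -!natr1; field.
Qed.

(** * Hit patterns of 2^j independent leaves *)

Section Pattern.
Variables (Om S : finType) (X : S -> {set Om}).
Hypothesis Om0 : (0 < #|Om|)%N.

(** In the application [Om] is the set of seeds and [X s] the seeds that talk in listening slot s;
    this is then the pattern of one half of the leaves. *)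
Definition hits k (z : {ffun 'I_k -> Om}) : {ffun S -> bool} :=
  [ffun s => [exists i, z i \in X s]].

Lemma card_miss k s :
  #|[set z : {ffun 'I_k -> Om} | ~~ hits z s]|%:R =
  #|{ffun 'I_k -> Om}|%:R * (1 - #|X s|%:R / #|Om|%:R) ^+ k :> R.
Proof.
have N0 : #|Om|%:R != 0 :> R by rewrite pnatr_eq0 -lt0n.
have -> : #|[set z : {ffun 'I_k -> Om} | ~~ hits z s]| = (#|~: X s| ^ k)%N.
  rewrite -[in RHS](card_ord k) -card_ffun_on; apply: eq_card => z.
  rewrite !inE ffunE negb_exists; apply/forallP/ffun_onP => H i.
    by rewrite inE H.
  by have := H i; rewrite inE.
rewrite card_ffun card_ord !natrX -exprMn; congr (_ ^+ _).
by rewrite mulrBr mulr1 mulrC mulfVK // cardsCs setCK natrB // max_card.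
Qed.

(* The first i with 2 ^ i * p >= 1, where p is the density of X s; cut off at J. *)
Definition scale J s : nat :=
  ex_minn (ex_intro (fun i => (#|Om| <= 2 ^ i * #|X s|)%N || (J <= i)%N) J
    (introT orP (or_intror (leqnn J)))).

(* With p and i as above, [hits z s] has for k = 2 ^ j the likely value (i <= j), and
   deviates from it with probability at most 2 ^ - offset. *)
Definition offset J s j : nat :=
  if (j < scale J s)%N then ((scale J s).-1 - j)%N else (j - scale J s)%N.

(** Above the scale i, all leaves miss with probability (1 - p)^(2^j) <= 1 / (1 + 2^j p) <= 2^-(j -
    i). Below it, the union bound 2^j p applies, and 2^(i-1) p < 1 by minimality of i. *)
Lemma card_hits_deviate J j s : (j < J)%N ->
  #|[set z : {ffun 'I_(2 ^ j) -> Om} | hits z s != (scale J s <= j)%N]|%:R <=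
  #|{ffun 'I_(2 ^ j) -> Om}|%:R * 2^-1 ^+ offset J s j :> R.
Proof.
move=> jJ; rewrite /offset /scale; case: ex_minnP => i iP imin.
set p : R := #|X s|%:R / #|Om|%:R.
have N0 : 0 < #|Om|%:R :> R by rewrite ltr0n.
have p01 : 0 <= p <= 1.
  by rewrite divr_ge0 //= ler_pdivrMr // mul1r ler_nat max_card.
set Z : R := #|{ffun 'I_(2 ^ j) -> Om}|%:R; have Z0 : 0 <= Z by [].
have [ij|ji] := leqP i j.
  have -> : [set z : {ffun 'I_(2 ^ j) -> Om} | hits z s != true] =
            [set z : {ffun 'I_(2 ^ j) -> Om} | ~~ hits z s].
    by apply/setP => z; rewrite !inE eqb_id.
  rewrite card_miss -/p ler_wpM2l //.
  have big : 2 ^+ (j - i) <= (2 ^ j)%:R * p.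
    have {}iP : (#|Om| <= 2 ^ i * #|X s|)%N.
      by case/orP: iP => // Ji; rewrite leqNgt (leq_trans jJ Ji) in ij.
    rewrite /p mulrA ler_pdivlMr // -natrX -!natrM ler_nat.
    by rewrite -[in leqRHS](subnK ij) expnD -mulnA leq_pmul2l // expn_gt0.
  have q0 : 0 <= (1 - p) ^+ (2 ^ j) by rewrite exprn_ge0 //; lra.
  rewrite exprVn -[leRHS]mul1r ler_pdivlMr ?exprn_gt0 //.
  apply: le_trans (bernoulli_inv (2 ^ j) p01); rewrite ler_wpM2l //; lra.
have -> : [set z : {ffun 'I_(2 ^ j) -> Om} | hits z s != false] =
          ~: [set z : {ffun 'I_(2 ^ j) -> Om} | ~~ hits z s].
  by apply/setP => z; rewrite !inE negbK; case: (hits z s).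
rewrite cardsCs setCK natrB ?max_card // card_miss -/p -/Z -[X in X - _]mulr1 -mulrBr.
rewrite ler_wpM2l //.
have small : (2 ^ j)%:R * p <= 2^-1 ^+ (i.-1 - j).
  have : ~~ ((#|Om| <= 2 ^ i.-1 * #|X s|)%N || (J <= i.-1)%N).
    by apply/negP => /imin; case: (i) ji => // i' _; rewrite ltnn.
  rewrite negb_or -ltnNge => /andP[lt _].
  have ji' : (j <= i.-1)%N by case: (i) ji.
  rewrite exprVn -[leRHS]mul1r ler_pdivlMr ?exprn_gt0 // /p mulrA mulrAC.
  rewrite ler_pdivrMr // mul1r -natrX -!natrM ler_nat mulnAC -expnD.
  by rewrite subnKC // ltnW.
by have := bernoulli_le (2 ^ j) p01; lra.
Qed.

(** An upper bound for the entropy of the pattern at scale j, slot by slot. *)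
Definition cost J j : R := \sum_s (offset J s j).+1%:R * 2^-1 ^+ offset J s j.

(** For fixed s, each offset occurs at most once below the scale and once above it; each side sums
    to at most 4. *)
Lemma sum_cost J : \sum_(j < J) cost J j <= 8 * #|S|%:R.
Proof.
rewrite exchange_big /= mulr_natr -sumr_const; apply: ler_sum => s _.
pose g d : R := d.+1%:R * 2^-1 ^+ d.
rewrite (eq_bigr (fun j : 'I_J => g (offset J s j))) //.
have iJ : (scale J s <= J)%N.
  by rewrite /scale; case: ex_minnP => i _ -> //; rewrite leqnn orbT.
rewrite -(big_mkord xpredT (fun j => g (offset J s j))).
rewrite (big_cat_nat (leq0n _) iJ) /=.
have -> : 8 = 4 + 4 :> R by lra.
apply: lerD.
  rewrite big_nat_rev /= big_nat (eq_bigr g); last first.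
    move=> d /andP[_ di]; rewrite add0n /offset.
    case: (scale J s) di => // i; rewrite ltnS => di.
    by rewrite subSS ltnS leq_subr /= subKn.
  by rewrite -big_nat big_mkord sum_arith_geom.
rewrite -{1}[scale J s]add0n big_addn (eq_bigr g); last first.
  by move=> d _; rewrite /offset ltnNge leq_addl /= addnK.
by rewrite big_mkord sum_arith_geom.
Qed.

Lemma expRN_le_half c : expR (- c%:R) <= 2^-1 ^+ c :> R.
Proof.
rewrite expRN exprVn lef_pV2 ?posrE ?expR_gt0 ?exprn_gt0 //.
rewrite -[c%:R]mulr1 expRM_natl; apply: lerXn2r; rewrite ?nnegrE ?expR_ge0 //.
by apply: le_trans (expR_ge1Dx 1).
Qed.

(** Gibbs' inequality with a product weight, which replaces subadditivity of entropy. With o the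
    offset and e = 2^-o, a slot has weight exp (- e) on its likely value and exp (- e - o) on the
    other; their sum is at most 1 because 1 + exp (- o) <= 1 + e <= exp e. The mean exponent costs
    at most o e + e. *)
Lemma hits_collision_ge J j : (j < J)%N ->
  (#|Om| ^ (2 ^ j + 2 ^ j))%:R * expR (- cost J j) <=
  #|[set p : {ffun 'I_(2 ^ j) -> Om} * {ffun 'I_(2 ^ j) -> Om} |
      hits p.1 == hits p.2]|%:R.
Proof.
move=> jJ; pose Zt := ({ffun 'I_(2 ^ j) -> Om} : finType).
have cZ : #|Zt| = (#|Om| ^ 2 ^ j)%N by rewrite card_ffun card_ord.
have Z0 : (0 < #|Zt|)%N by rewrite cZ expn_gt0 Om0.
pose dev s (a : bool) := a != (scale J s <= j)%N.
pose w s (a : bool) : R :=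
  - ((dev s a)%:R * (offset J s j)%:R + 2^-1 ^+ offset J s j).
pose u (f : {ffun S -> bool}) : R := \sum_s w s (f s).
have u1 : \sum_f expR (u f) <= 1.
  rewrite (eq_bigr (fun f : {ffun S -> bool} => \prod_s expR (w s (f s)))); last first.
    by move=> f _; rewrite expR_sum.
  rewrite -(bigA_distr_bigA (fun s a => expR (w s a))) /=.
  apply: prodr_ile1 => s _; apply/andP; split.
    by apply: sumr_ge0 => a _; apply: expR_ge0.
  have -> : \sum_(a : bool) expR (w s a) =
     expR (- 2^-1 ^+ offset J s j) * (1 + expR (- (offset J s j)%:R)).
    rewrite big_bool /w /dev; case: (scale J s <= j)%N => /=;
      rewrite mul0r mul1r add0r opprD expRD; ring.
  rewrite expRN mulrC ler_pdivrMr ?expR_gt0 // mul1r.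
  apply: le_trans (expR_ge1Dx _); rewrite lerD2l; exact: expRN_le_half.
have := collision_ge (@hits (2 ^ j)) Z0 u1; apply: le_trans.
rewrite cZ -natrX -expnM muln2 -addnn ler_wpM2l // ler_expR.
rewrite /cost lerNl /u exchange_big /= -mulNr -sumrN mulr_suml.
apply: ler_sum => s _; have := card_hits_deviate s jJ; rewrite cZ.
set Zr : R := (#|Om| ^ 2 ^ j)%:R; have Zr0 : 0 < Zr by rewrite /Zr -cZ ltr0n.
set o := offset J s j; set e := 2^-1 ^+ o; set D := #|_| => devle.
have -> : - \sum_(z : Zt) w s (hits z s) = D%:R * o%:R + Zr * e.
  rewrite -sumrN (eq_bigr (fun z : Zt => (dev s (hits z s))%:R * o%:R + e)); last first.
    by move=> z _; rewrite opprK.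
  rewrite big_split /= sumr_const cZ -mulr_suml; congr (_ * _ + _).
    rewrite -natr_sum /D -sum1_card [in RHS]big_mkcond; congr _%:R.
    by apply: eq_bigr => z _; rewrite inE /dev; case: ifP.
  by rewrite mulr_natl.
rewrite ler_pdivrMr // -natr1.
have : 0 <= o%:R :> R by [].
nra.
Qed.

(** All scales are summed instead of picking a good one, since a good scale may depend on the seeds
    of the hubs. The mean cost is at most 8 |S| / J, and exp is convex. *)
Lemma sum_hits_collision_ge J : (0 < J)%N ->
  J%:R * expR (- (8 * #|S|%:R / J%:R)) <=
  \sum_(j < J) #|[set p : {ffun 'I_(2 ^ j) -> Om} * {ffun 'I_(2 ^ j) -> Om} |
      hits p.1 == hits p.2]|%:R / (#|Om| ^ (2 ^ j + 2 ^ j))%:R :> R.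
Proof.
move=> J0; have Jr : 0 < J%:R :> R by rewrite ltr0n.
set a := 8 * _ / _.
(* The tangent of exp at - a: exp (- x) >= exp (- a) * (1 + a - x). *)
apply: le_trans (_ : \sum_(j < J) expR (- a) * (1 + (a - cost J j)) <= _).
  rewrite -mulr_sumr mulrC ler_wpM2l ?expR_ge0 // big_split /= sumrB !sumr_const.
  rewrite card_ord -[a *+ J]mulr_natr /a mulfVK ?gt_eqF //.
  by rewrite lerDl subr_ge0 sum_cost.
apply: ler_sum => j _; rewrite ler_pdivlMr; last by rewrite ltr0n expn_gt0 Om0.
apply: le_trans (hits_collision_ge (ltn_ord j)); rewrite [leRHS]mulrC.
rewrite ler_wpM2r //; apply: le_trans (_ : expR (- a) * expR (a - cost J j) <= _).
  by rewrite ler_wpM2l ?expR_ge0 ?expR_ge1Dx.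
by rewrite -expRD addrA addNr add0r.
Qed.

End Pattern.

Lemma trunc_log_le (n : nat) (x : R) : (0 < n)%N -> n%:R <= expR x ->
  (trunc_log 2 n)%:R <= 2 * x.
Proof.
move=> n0 nx; set l := trunc_log 2 n.
have ln : (2 ^ l <= n)%N by rewrite trunc_logP.
have : expR (l%:R / 2) <= expR x.
  apply: le_trans nx; apply: le_trans (_ : (2 ^ l)%:R <= _); last by rewrite ler_nat.
  rewrite expRM_natl natrX; apply: lerXn2r; rewrite ?nnegrE ?expR_ge0 //.
  (* The inequality exp (1/2) <= 2, obtained from exp (- 1/2) >= 1/2. *)
  have := expR_ge1Dx (- 2^-1 : R); rewrite expRN => h.
  have e0 := expR_gt0 (2^-1 : R).
  rewrite -[leLHS]invrK -[leRHS]invrK lef_pV2 ?posrE ?invr_gt0 //; lra.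
by rewrite ler_expR; lra.
Qed.

End Collisions.

(** * Leaves in unison and counting of failing seeds *)

Lemma unison_no_lone_talker (I : Type) cd (A : algo I) k (inp : 'I_k.+2 -> I) T :
    1 < k ->
    (forall x y t, t <= T ->
      (shadow cd A (inp ord0) (inp (sink k)) (inp (leaf x)) t).1 =
      (shadow cd A (inp ord0) (inp (sink k)) (inp (leaf y)) t).1) ->
    (forall x y t, t < T ->
      hub_listens cd A (inp ord0) (inp (sink k)) (inp (leaf x)) t ->
      talks cd A (inp ord0) (inp (sink k)) (inp (leaf x)) t =
      talks cd A (inp ord0) (inp (sink k)) (inp (leaf y)) t) ->
  no_lone_talker cd A inp T.
Proof.
move=> k1 same unison; split=> // t x tT lx.
have -> : [set y | talks cd A (inp ord0) (inp (sink k)) (inp (leaf y)) t] =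
    if talks cd A (inp ord0) (inp (sink k)) (inp (leaf x)) t then setT else set0.
  by apply/setP => y; rewrite inE -(unison x y) //; case: ifP; rewrite inE.
by case: ifP => _; rewrite ?cardsT ?card_ord ?cards0 ?k1 //; case: (k) k1 => [|[]].
Qed.

Section Randomized.
Variables (cd : bool) (R T : nat) (A : algo (seq bool * option nat)).
Variable m : nat.

Notation seed := (R.-tuple bool).
Implicit Types s r : seed.

Let leaf_in r : seq bool * option nat := (tval r, None).

Definition rshadow s0 s1 r :=
  shadow cd A (tval s0, Some m) (tval s1, None) (leaf_in r).
Definition rlistens s0 s1 r t :=
  hub_listens cd A (tval s0, Some m) (tval s1, None) (leaf_in r) t.
Definition rtalks s0 s1 r t :=
  talks cd A (tval s0, Some m) (tval s1, None) (leaf_in r) t.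

Lemma rand_input_leaf k s0 s1 (z : 'I_k -> seed) x :
  rand_input m [ffun v => vfun s0 s1 z v] (leaf x) = leaf_in (z x).
Proof. by rewrite /rand_input ffunE vfun_leaf. Qed.

Lemma rand_input_source k s0 s1 (z : 'I_k -> seed) :
  rand_input m [ffun v => vfun s0 s1 z v] ord0 = (tval s0, Some m).
Proof. by rewrite /rand_input ffunE vfun_source /src_info eqxx. Qed.

Lemma rand_input_sink k s0 s1 (z : 'I_k -> seed) :
  rand_input m [ffun v => vfun s0 s1 z v] (sink k) = (tval s1, None).
Proof. by rewrite /rand_input ffunE vfun_sink. Qed.

Definition rand_inputE := (rand_input_leaf, rand_input_source, rand_input_sink).

(** The shadow of r is realized on K_{2,2} by giving both leaves the seed r, so the energy bound
    applies to it. *)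
Lemma sum_rlistens_le Delta E s0 s1 r : 1 < Delta -> rand_energy_le cd Delta R T A E ->
  \sum_(t < T) rlistens s0 s1 r t <= E + E.
Proof.
move=> D1 en; pose inp := rand_input m [ffun v => vfun s0 s1 (fun _ : 'I_2 => r) v].
have nl : no_lone_talker cd A inp T.
  by apply: unison_no_lone_talker => // x y t _; rewrite /inp !rand_inputE.
have := sum_hub_listens_le ord0 (leqnn T) nl; rewrite /inp !rand_inputE.
by move/leq_trans; apply; apply: leq_add; apply: en.
Qed.

Definition join_halves k (z z' : {ffun 'I_k -> seed}) (x : 'I_(k + k)) : seed :=
  match split x with inl i => z i | inr i => z' i end.

Lemma join_halves_l k (z z' : {ffun 'I_k -> seed}) i :
  join_halves z z' (lshift k i) = z i.
Proof. by rewrite /join_halves (unsplitK (inl i : 'I_k + 'I_k)). Qed.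

Lemma join_halves_r k (z z' : {ffun 'I_k -> seed}) i :
  join_halves z z' (rshift k i) = z' i.
Proof. by rewrite /join_halves (unsplitK (inr i : 'I_k + 'I_k)). Qed.

(** Distinct bad quadruples (s0, s1, z, z') give distinct seed assignments on K_{2,2k}, and the sink
    fails on each of them. *)
Lemma fail_count n Delta k (bad : seed -> seed -> rel {ffun 'I_k -> seed}) :
    0 < k -> k + k <= Delta -> rand_broadcast_whp cd n Delta R T A ->
    (forall s h, size h = T -> ~~ has is_msg h -> out A (tval (s : seed), None) h < m) ->
    (forall s0 s1 z z', bad s0 s1 z z' ->
      no_lone_talker cd A
        (rand_input m [ffun v => vfun s0 s1 (join_halves z z') v]) T) ->
  (\sum_(q : seed * seed) #|[set p | bad q.1 q.2 p.1 p.2]|) * n <=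
  #|{: seed}| ^ (k + k + 2).
Proof.
move=> k0 kD whp small nl.
have kk : 0 < k + k <= Delta by rewrite addn_gt0 k0.
have := whp _ kk m; rewrite card_tuple card_bool -expnM addn2; apply: leq_trans.
rewrite leq_mul2r; apply/orP; right.
pose Z := ({ffun 'I_k -> seed} : finType).
pose f (q : (seed * seed) * (Z * Z)) : {ffun 'I_(k + k).+2 -> seed} :=
  [ffun v => vfun q.1.1 q.1.2 (join_halves q.2.1 q.2.2) v].
have f_inj : injective f.
  move=> [[s0 s1] [z z']] [[t0 t1] [w w']] /ffunP fE.
  have := fE ord0; rewrite !ffunE !vfunE /= => ->.
  have := fE (sink _); rewrite !ffunE !vfunE /= => ->.
  congr (_, (_, _)); apply/ffunP => i.
    by have := fE (leaf (lshift k i)); rewrite !ffunE !vfunE /= !join_halves_l.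
  by have := fE (leaf (rshift k i)); rewrite !ffunE !vfunE /= !join_halves_r.
have -> : \sum_(q : seed * seed) #|[set p | bad q.1 q.2 p.1 p.2]| =
    #|[set q : (seed * seed) * (Z * Z) | bad q.1.1 q.1.2 q.2.1 q.2.2]|.
  rewrite -sum1_card (eq_bigl (fun q : (seed * seed) * (Z * Z) =>
    bad q.1.1 q.1.2 q.2.1 q.2.2)) => [|q]; last by rewrite inE.
  rewrite -(pair_big_dep xpredT (fun (a : seed * seed) (p : Z * Z) =>
    bad a.1 a.2 p.1 p.2) (fun _ _ => 1)) /=.
  by apply: eq_bigr => q _; rewrite -sum1_card; apply: eq_bigl => p; rewrite inE.
rewrite -(card_imset _ f_inj); apply: subset_leq_card; apply/subsetP => ? /imsetP[q + ->].
rewrite !inE => /nl nlq; apply: no_lone_talker_fails nlq _; first by rewrite addn_gt0 k0.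
by rewrite rand_inputE; apply: small.
Qed.

End Randomized.

(** * Randomized bound without collision detection *)

Section NoCD.
Variables (R T : nat) (A : algo (seq bool * option nat)) (m : nat).
Notation seed := (R.-tuple bool).

(** The all-false leaf seed is an arbitrary choice, as the hub schedule does not depend on the
    leaves. *)
Definition listening_slot (s0 s1 : seed) : finType :=
  {t : 'I_T | rlistens false A m s0 s1 [tuple of nseq R false] t}.

Definition slot_talkers s0 s1 (t : listening_slot s0 s1) : {set seed} :=
  [set r | rtalks false A m s0 s1 r (val t)].

Lemma card_listening_slot Delta E s0 s1 :
  1 < Delta -> rand_energy_le false Delta R T A E ->
  #|listening_slot s0 s1| <= E + E.
Proof.
move=> D1 en; rewrite card_sig -sum1_card big_mkcond /=.
apply: leq_trans (sum_rlistens_le m s0 s1 [tuple of nseq R false] D1 en).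
by apply: leq_sum => t _; rewrite unfold_in; case: ifP.
Qed.

(** A talker in one half always has a companion in the other half. *)
Lemma same_hits_no_lone_talker s0 s1 k (z z' : {ffun 'I_k -> seed}) :
    hits (@slot_talkers s0 s1) z == hits (@slot_talkers s0 s1) z' ->
  no_lone_talker false A (rand_input m [ffun v => vfun s0 s1 (join_halves z z') v]) T.
Proof.
move=> /eqP/ffunP E; apply: no_lone_talker_nocd => t x tT.
rewrite !rand_inputE (hub_listens_nocd _ _ _ _ (tval [tuple of nseq R false], None)).
move=> lt; pose s : listening_slot s0 s1 := exist _ (Ordinal tT) lt.
have talkE y : talks false A (tval s0, Some m) (tval s1, None)
    (rand_input m [ffun v => vfun s0 s1 (join_halves z z') v] (leaf y)) t =
    (join_halves z z' y \in slot_talkers s) by rewrite rand_inputE inE.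
apply: card_neq1 => y; rewrite inE talkE.
have := E s; rewrite !ffunE; case: (split_ordP y) => i ->.
  rewrite join_halves_l => + zi; have -> : [exists i, z i \in slot_talkers s].
    by apply/existsP; exists i.
  move/esym/existsP => [j z'j]; exists (rshift k j).
    by rewrite inE talkE join_halves_r.
  by rewrite eq_sym eq_lrshift.
rewrite join_halves_r => + zi; have -> : [exists i, z' i \in slot_talkers s].
  by apply/existsP; exists i.
move=> /existsP [j zj]; exists (lshift k j); first by rewrite inE talkE join_halves_l.
by rewrite eq_lrshift.
Qed.

End NoCD.

Import Order.TTheory GRing.Theory Num.Theory.

Lemma rand_nocd_lower Delta n R T E (A : algo (seq bool * option nat)) :
    1 < Delta -> Delta.+2 <= n ->
    rand_broadcast_whp false n Delta R T A -> rand_energy_le false Delta R T A E ->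
  trunc_log 2 Delta * trunc_log 2 n <= 32 * E.
Proof.
move=> D1 Dn whp en; set J := trunc_log 2 Delta.
have n0 : 0 < n by apply: leq_trans Dn.
have J0 : 0 < J by rewrite trunc_log_gt0.
have [m small] := @fresh_message (R.-tuple bool) T (fun s h => out A (tval s, None) h).
pose talkers s0 s1 := @slot_talkers R T A m s0 s1.
pose N := #|{: R.-tuple bool}|.
have N0 : 0 < N by rewrite /N card_tuple card_bool expn_gt0.
pose Z j := ({ffun 'I_(2 ^ j) -> R.-tuple bool} : finType).
pose C j s0 s1 := #|[set p : Z j * Z j |
   hits (talkers s0 s1) p.1 == hits (talkers s0 s1) p.2]|.
have up j : j < J ->
    (\sum_(q : R.-tuple bool * R.-tuple bool) C j q.1 q.2) * n <=
    N ^ (2 ^ j + 2 ^ j + 2).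
  move=> jJ; apply: (fail_count (m := m) (k := 2 ^ j) (bad := fun s0 s1 z z' =>
    hits (talkers s0 s1) z == hits (talkers s0 s1) z') _ _ whp) => //.
  - by rewrite expn_gt0.
  - rewrite addnn -mul2n -expnS; apply: leq_trans (trunc_logP (isT : 1 < 2) (ltnW D1)).
    by rewrite leq_exp2l.
  - by move=> s0 s1 z z'; apply: same_hits_no_lone_talker.
Local Open Scope ring_scope.
pose F := (Rdefinitions.R : realType).
have Jr : 0 < J%:R :> F by rewrite ltr0n.
have Nr : 0 < N%:R :> F by rewrite ltr0n.
have nr : 0 < n%:R :> F by rewrite ltr0n.
(* This is 8 |S| / J with at most 2E listening slots. *)
pose a : F := 16 * E%:R / J%:R.
have low s0 s1 : J%:R * expR (- a) <=
    \sum_(j < J) (C j s0 s1)%:R / (N ^ (2 ^ j + 2 ^ j))%:R.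
  apply: le_trans (sum_hits_collision_ge F (talkers s0 s1) N0 J0).
  rewrite ler_wpM2l // ler_expR lerN2 /a ler_wpM2r ?invr_ge0 //.
  have : #|listening_slot T A m s0 s1|%:R <= (E + E)%:R :> F.
    by rewrite ler_nat; apply: card_listening_slot D1 en.
  by rewrite natrD; lra.
(* Summed over hub seeds and scales, the two bounds compare N^2 J exp (- a) with J N^2 / n. *)
have : \sum_(q : R.-tuple bool * R.-tuple bool) J%:R * expR (- a) <=
    \sum_(j < J) N%:R ^+ 2 / n%:R.
  apply: le_trans (ler_sum _ (fun q _ => low q.1 q.2)) _; rewrite exchange_big /=.
  apply: ler_sum => j _; rewrite -mulr_suml -natr_sum ler_pdivlMr // mulrAC ler_pdivrMr.
    by rewrite -natrX -!natrM ler_nat -expnD (addnC 2%N) up.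
  by rewrite ltr0n expn_gt0 N0.
rewrite !sumr_const card_ord card_prod -/N -[leLHS]mulr_natl -[leRHS]mulr_natl.
rewrite natrM -expr2 [leRHS]mulrCA ler_pM2l ?exprn_gt0 //.
(* What remains is n <= exp a, whence log n <= 2 a = 32 E / J. *)
rewrite ler_pM2l // expRN lef_pV2 ?posrE ?expR_gt0 // => /(trunc_log_le n0).
rewrite /a => h; rewrite -(ler_nat F) natrM natrM mulrC -ler_pdivlMr //; lra.
Qed.
Local Close Scope ring_scope.

(** * Randomized bound with collision detection *)

Section CD.
Variables (R T : nat) (A : algo (seq bool * option nat)) (m : nat).
Notation seed := (R.-tuple bool).
Variables s0 s1 : seed.

Let bits (r : seed) t : seq bool :=
  [seq rtalks true A m s0 s1 r i | i <- iota 0 t & rlistens true A m s0 s1 r i].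

(** Padding to the fixed length B leaves at most 2^B values. *)
Definition transcript B (r : seed) : B.-tuple bool :=
  [tuple nth false (bits r T) i | i < B].

Lemma bitsS r t : bits r t.+1 =
  if rlistens true A m s0 s1 r t then rcons (bits r t) (rtalks true A m s0 s1 r t)
  else bits r t.
Proof.
rewrite /bits -addn1 iotaD filter_cat map_cat add0n /=.
by case: ifP => _ /=; rewrite ?cats1 ?cats0.
Qed.

Lemma bits_prefix r t : t <= T -> prefix (bits r t) (bits r T).
Proof.
move=> tT; rewrite /bits.
have -> : iota 0 T = iota 0 t ++ iota t (T - t) by rewrite -{1}(subnKC tT) iotaD.
rewrite filter_cat map_cat.
exact: prefix_prefix.
Qed.

(** The bits recorded before slot t form a prefix of all bits, so their number is the position of
    the bit of slot t. *)
Lemma nth_transcript B r t : \sum_(t < T) rlistens true A m s0 s1 r t <= B ->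
    t < T -> rlistens true A m s0 s1 r t ->
  size (bits r t) < B /\
  nth false (transcript B r) (size (bits r t)) = rtalks true A m s0 s1 r t.
Proof.
move=> leB tT lt; have /prefixP[b Eb] := bits_prefix r tT.
rewrite bitsS lt in Eb.
have sB : size (bits r t) < B.
  apply: leq_trans leB; apply: (@leq_trans (size (bits r T))).
    by rewrite Eb size_cat size_rcons leq_addr.
  rewrite size_map size_filter -sum1_count big_mkcond /=.
  have -> : iota 0 T = index_iota 0 T by rewrite /index_iota subn0.
  by rewrite big_mkord; apply: leq_sum => i _; case: ifP.
split=> //; rewrite -[size _]/(val (Ordinal sB)) -tnth_nth tnth_mktuple /=.
by rewrite Eb nth_cat size_rcons ltnSn nth_rcons ltnn eqxx.
Qed.

(** By induction on slots: equal hub histories give equal listening decisions, and the next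
    transcript bit gives equal observations. The bit counts are carried along so that both runs read
    the same position. *)
Lemma eq_transcript B r r' :
    (forall r, \sum_(t < T) rlistens true A m s0 s1 r t <= B) ->
    transcript B r = transcript B r' ->
  forall t, t <= T -> (rshadow true A m s0 s1 r t).1 = (rshadow true A m s0 s1 r' t).1 /\
    size (bits r t) = size (bits r' t).
Proof.
move=> leB Eg; elim=> // t IH tT; have [Es Eb] := IH (ltnW tT).
have El : rlistens true A m s0 s1 r t = rlistens true A m s0 s1 r' t.
  by move: Es; rewrite /rlistens /hub_listens /rshadow => ->.
rewrite !bitsS -El; case: ifP => [l|/negbT]; last first.
  rewrite negb_or => /andP[l0 l1]; split=> //; move: Es l0 l1.
  rewrite /rshadow /= => <-.
  by case: (act _ _ _) => //=; case: (act _ _ _).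
have [_ <-] := nth_transcript (leB r) tT l.
rewrite El in l; have [_ Et] := nth_transcript (leB r') tT l.
rewrite !size_rcons Eb; split=> //.
have {}Et : rtalks true A m s0 s1 r t = rtalks true A m s0 s1 r' t.
  by rewrite -Et -Eg -Eb; have [_ ->] := nth_transcript (leB r) tT (etrans El l).
by move: Es Et; rewrite /rshadow /rtalks /talks /= => -> ->.
Qed.

Lemma eq_transcript_no_lone_talker B (z z' : {ffun 'I_1 -> seed}) :
    (forall r, \sum_(t < T) rlistens true A m s0 s1 r t <= B) ->
    transcript B (z ord0) = transcript B (z' ord0) ->
  no_lone_talker true A (rand_input m [ffun v => vfun s0 s1 (join_halves z z') v]) T.
Proof.
move=> leB Eg.
have E x y : transcript B (join_halves z z' x) = transcript B (join_halves z z' y).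
  by case: (split_ordP x) => i ->; case: (split_ordP y) => j ->;
    rewrite ?join_halves_l ?join_halves_r !ord1.
apply: unison_no_lone_talker => // x y t tT; rewrite !rand_inputE.
  by have [] := eq_transcript leB (E x y) tT.
move=> lx; have [Es Eb] := eq_transcript leB (E x y) (ltnW tT).
have ly : rlistens true A m s0 s1 (join_halves z z' y) t.
  by move: lx Es; rewrite /rlistens /hub_listens /rshadow => + <-.
have [_ Ex] := nth_transcript (leB _) tT lx.
have [_ Ey] := nth_transcript (leB _) tT ly.
by apply: etrans (esym Ex) (etrans _ Ey); rewrite Eb (E x y).
Qed.

End CD.

Lemma rand_cd_lower Delta n R T E (A : algo (seq bool * option nat)) :
    1 < Delta -> Delta.+2 <= n ->
    rand_broadcast_whp true n Delta R T A -> rand_energy_le true Delta R T A E ->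
  trunc_log 2 n <= 4 * E.
Proof.
move=> D1 Dn whp en.
have n0 : 0 < n by apply: leq_trans Dn.
have [m small] := @fresh_message (R.-tuple bool) T (fun s h => out A (tval s, None) h).
have leB s0 s1 r := sum_rlistens_le m s0 s1 r D1 en.
pose Z := ({ffun 'I_1 -> R.-tuple bool} : finType).
pose N := #|{: R.-tuple bool}|.
have cZ : #|Z| = N by rewrite card_ffun card_ord expn1.
have N0 : 0 < N by rewrite /N card_tuple card_bool expn_gt0.
pose b s0 s1 (z : Z) := transcript T A m s0 s1 (E + E) (z ord0).
pose C s0 s1 := #|[set p : Z * Z | b s0 s1 p.1 == b s0 s1 p.2]|.
have up : (\sum_(q : R.-tuple bool * R.-tuple bool) C q.1 q.2) * n <= N ^ 4.
  apply: (fail_count (m := m) (k := 1) (bad := fun s0 s1 z z' =>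
    b s0 s1 z == b s0 s1 z') _ _ whp) => // s0 s1 z z' /eqP.
  exact: eq_transcript_no_lone_talker.
Local Open Scope ring_scope.
pose F := (Rdefinitions.R : realType).
have Nr : 0 < N%:R :> F by rewrite ltr0n.
have nr : 0 < n%:R :> F by rewrite ltr0n.
have low s0 s1 : N%:R ^+ 2 * expR (- (E + E)%:R) <= (C s0 s1)%:R :> F.
  have Z0 : (0 < #|Z|)%N by rewrite cZ.
  (* The uniform weight exp (- 2E) on the 2^(2E) transcripts sums to at most 1 because e >= 2. *)
  have u1 : \sum_(f : (E + E).-tuple bool) expR (- (E + E)%:R) <= 1 :> F.
    rewrite sumr_const card_tuple card_bool -[leLHS]mulr_natr natrX.
    apply: le_trans (ler_wpM2r _ (expRN_le_half F (E + E))) _; first by rewrite exprn_ge0.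
    by rewrite -exprMn mulVf ?expr1n ?pnatr_eq0.
  have := collision_ge (b s0 s1) Z0 u1; rewrite cZ sumr_const cZ.
  by rewrite -[X in expR (X / _)]mulr_natr mulfK // gt_eqF.
have : N%:R ^+ 4 * (expR (- (E + E)%:R) * n%:R) <= N%:R ^+ 4 * 1 :> F.
  rewrite mulr1 -[leRHS]natrX.
  have := up; rewrite -(ler_nat F); apply: le_trans.
  rewrite natrM mulrA ler_wpM2r // natr_sum.
  apply: le_trans (ler_sum _ (fun q _ => low q.1 q.2)).
  by rewrite sumr_const card_prod -/N -[leRHS]mulr_natl natrM mulrA -expr2 -exprD.
rewrite ler_pM2l ?exprn_gt0 // expRN mulrC ler_pdivrMr ?expR_gt0 // mul1r.
(* From n <= exp (2E), log n <= 2 * 2E, which is the constant 4. *)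
move/(trunc_log_le n0) => h; rewrite -(ler_nat F); apply: le_trans h _.
by rewrite natrD natrM; lra.
Qed.
Local Close Scope ring_scope.

(* cd = false : No-CD model;  cd = true : CD model.
   log is trunc_log 2 (floor of log base 2). *)
Theorem theorem2 :
  (* (i) deterministic No-CD: Omega(Delta) energy *)
  (exists c Delta0 : nat, 0 < c /\
     forall (Delta n N T E : nat) (A : algo (nat * option nat)),
       Delta0 <= Delta -> Delta.+2 <= n -> n <= N ->
       det_broadcast_ok false N Delta T A ->
       det_energy_le false N Delta T A E ->
       Delta <= c * E)
  /\
  (* (ii) randomized No-CD, w.h.p.: Omega(log Delta * log n) energy *)
  (exists c n0 Delta0 : nat, 0 < c /\
     forall (Delta n R T E : nat) (A : algo (seq bool * option nat)),
       Delta0 <= Delta -> n0 <= n -> Delta.+2 <= n ->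
       rand_broadcast_whp false n Delta R T A ->
       rand_energy_le false Delta R T A E ->
       trunc_log 2 Delta * trunc_log 2 n <= c * E)
  /\
  (* (iii) randomized CD, w.h.p.: Omega(log n) energy *)
  (exists c n0 : nat, 0 < c /\
     forall (Delta n R T E : nat) (A : algo (seq bool * option nat)),
       2 <= Delta -> n0 <= n -> Delta.+2 <= n ->
       rand_broadcast_whp true n Delta R T A ->
       rand_energy_le true Delta R T A E ->
       trunc_log 2 n <= c * E).
Proof.
split; last split.
- exists 3, 2; split=> // Delta n N T E A D1 Dn nN.
  exact: det_nocd_lower (leq_trans Dn nN).
- exists 32, 0, 2; split=> // Delta n R T E A D1 _.
  exact: rand_nocd_lower.
exists 4, 0; split=> // Delta n R T E A D1 _.
exact: rand_cd_lower.
Qed.
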